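(* Let $F$ be any field, and $m$ and $n$ arbitrary positive integers. Then there exists an $F$-subalgebra $R$ of $\mathbb{M}_n(F)$ with Lie nilpotence index $m$ such that $$\dim_F R=M(m+1,n).$$
   Context: All rings are associative with identity, and subalgebras contain the identity. $\mathbb{M}_n(F)$ is the $F$-algebra of $n\times n$ matrices over $F$. In a ring $R$ put $[r,s]=rs-sr$, $[x_1]^*=x_1$ and $[x_1,\ldots,x_k]^*=[[x_1,\ldots,x_{k-1}]^*,x_k]$ for $k>1$. $R$ is Lie nilpotent of index $m$ (has Lie nilpotence index $m$) if $[x_1,x_2,\ldots,x_{m+1}]^*=0$ for all $x_1,\ldots,x_{m+1}\in R$ (minimality of $m$ is not required). For positive integers $\ell,n$, $$M(\ell,n)=\max\Big\{\tfrac12\Big(n^2-\sum_{i=1}^{\ell}k_i^2\Big)+1 : k_1,\ldots,k_\ell \text{ nonnegative integers with } \sum_{i=1}^{\ell}k_i=n\Big\}.$$ *)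

(* Defs.v *)
From mathcomp Require Import all_boot all_order all_algebra.

Set Implicit Arguments.
Unset Strict Implicit.
Unset Printing Implicit Defensive.

Import GRing.Theory.

Section LieNilpotence.
Local Open Scope ring_scope.
Variable R : pzRingType.
Implicit Types (x y : R) (s : seq R) (S : {pred R}).

Definition lie_bracket x y : R := x * y - y * x.

(* [x_1, ..., x_k]^* is [lie_comm x_1 [:: x_2; ...; x_k]]. *)
Definition lie_comm x s : R := foldl lie_bracket x s.

(* [m] is not required to be minimal. *)
Definition lie_nilpotent (m : nat) S : Prop :=
  forall x s, size s = m -> x \in S -> {subset s <= S} -> lie_comm x s = 0.

End LieNilpotence.

(* Summands k_i with sum n are at most n, so ranging over 'I_n.+1 loses       *)
(* nothing; the maximum is over a nonempty set whenever 0 < l. Neither the    *)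
(* truncated subtraction nor the halving loses anything: see maxdim_exact.    *)
Definition maxdim (l n : nat) : nat :=
  \max_(k : {ffun 'I_l -> 'I_n.+1} | \sum_(i < l) k i == n)
     ((n ^ 2 - \sum_(i < l) k i ^ 2) %/ 2 + 1).

Lemma maxdim_exact (l n : nat) (k : 'I_l -> nat) :
  \sum_(i < l) k i = n ->
  2 * ((n ^ 2 - \sum_(i < l) k i ^ 2) %/ 2) + \sum_(i < l) k i ^ 2 = n ^ 2.
Proof.
move=> <-.
have [q ->] : exists q, (\sum_(i < l) k i) ^ 2 = 2 * q + \sum_(i < l) k i ^ 2.
  elim/big_rec2: _ => [|i s t _ [q e]]; first by exists 0.
  by exists (q + k i * t); rewrite sqrnD e mulnDr addnCA addnAC.
by rewrite addnK mulKn.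
Qed.

(* Main.v *)
From HB Require Import structures.
Require Import Defs.
From mathcomp Require Import all_boot all_order all_algebra.

(* Extremal example: cut the rows and columns of an n x n matrix into m + 1   *)
(* blocks of sizes k_i and let R consist of the scalar matrices plus the      *)
(* strictly block upper triangular ones.  Scalars drop out of commutators, so *)
(* a bracket of depth m is strictly upper triangular of order m + 1, hence 0. *)

Set Implicit Arguments.
Unset Strict Implicit.
Unset Printing Implicit Defensive.

Import GRing.Theory.

Local Open Scope ring_scope.

(** Filter matrices by how far their nonzero entries lie above the block diagonal: [shifted d] means
    at least [d] blocks above it. Degrees add under multiplication ([shiftedM]), so scalars plus
    degree 1 form a subalgebra. Scalars are central, so the first bracket has degree 2 and each
    later one gains 1. After [m] brackets the degree is [m.+1], which block indices at most [m] do
    not allow. The dimension is 1, for the scalars, plus the number of pairs with [b i < b j]. By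
    symmetry this number is half of [n ^ 2] minus the pairs inside one block, the sum of the squared
    block sizes ([card_lt_pairs]). Block sizes attaining the maximum finish the proof. *)

Section Shifted.
Variables (F : fieldType) (n : nat) (b : 'I_n -> nat).
Implicit Types (A B : 'M[F]_n) (d e : nat).

(* [b i] is the index of the block containing row and column [i]. *)
Definition shifted d A := forall i j, A i j != 0 -> (b i + d <= b j)%N.

Lemma shiftedD d A B : shifted d A -> shifted d B -> shifted d (A + B).
Proof.
move=> sA sB i j; have [A0|/sA //] := eqVneq (A i j) 0.
by rewrite !mxE A0 add0r => /sB.
Qed.

Lemma shiftedZ d c A : shifted d A -> shifted d (c *: A).
Proof. by move=> sA i j; rewrite mxE mulf_eq0 negb_or => /andP[_ /sA]. Qed.

Lemma shiftedB d A B : shifted d A -> shifted d B -> shifted d (A - B).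
Proof. by move=> sA sB; rewrite -scaleN1r; apply/shiftedD/shiftedZ. Qed.

Lemma shiftedM d e A B :
  shifted d A -> shifted e B -> shifted (d + e) (A * B).
Proof.
move=> sA sB i j; apply: contraNT => ltbj; rewrite mxE big1 // => k _.
apply/eqP; rewrite mulf_eq0; apply: contraNT ltbj.
rewrite negb_or => /andP[/sA ik /sB kj].
by rewrite addnA (leq_trans _ kj) // leq_add2r.
Qed.

Lemma shiftedW d e A : (e <= d)%N -> shifted d A -> shifted e A.
Proof.
by move=> le_ed sA i j /sA; apply: leq_trans; rewrite leq_add2l.
Qed.

Definition scalar_plus_strict A := exists c B, A = c%:M + B /\ shifted 1 B.

Lemma scalar_plus_strict_mulr_closed A B :
  scalar_plus_strict A -> scalar_plus_strict B -> scalar_plus_strict (A * B).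
Proof.
move=> [c [A' [-> sA]]] [d [B' [-> sB]]].
exists (c * d), (c *: B' + (d *: A' + A' * B')); split.
  have scM a (C : 'M[F]_n) : a%:M * C = a *: C by apply: mul_scalar_mx.
  have Msc a (C : 'M[F]_n) : C * a%:M = a *: C by apply: mul_mx_scalar.
  by rewrite mulrDl !mulrDr -addrA Msc scale_scalar_mx mulrC scM Msc.
apply: shiftedD; first exact: shiftedZ.
by apply: shiftedD; [exact: shiftedZ | exact: shiftedW (shiftedM sA sB)].
Qed.

(** Both scalar parts cancel, leaving products of degrees [d.+1] and 1. A general [c] serves the
    first bracket, and [c = 0] the later ones. *)
Lemma lie_bracket_shifted d c A B :
  shifted d.+1 A -> scalar_plus_strict B ->
  shifted d.+2 (lie_bracket (c%:M + A) B).
Proof.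
move=> sA [e [B' [-> sB]]].
have scC a (C : 'M[F]_n) : a%:M * C = C * a%:M by symmetry; apply: scalar_mxC.
have -> : lie_bracket (c%:M + A) (e%:M + B') = A * B' - B' * A.
  rewrite /lie_bracket !mulrDl !mulrDr (scC c e%:M) (scC c B') -(scC e A).
  rewrite [X in _ - X]addrACA opprD addrACA subrr add0r.
  by rewrite opprD addrACA subrr add0r.
have := shiftedM sB sA; rewrite add1n => sBA.
have := shiftedM sA sB; rewrite addn1 => sAB.
exact: shiftedB.
Qed.

Lemma lie_comm_shifted d A (s : seq 'M[F]_n) :
  shifted d.+1 A -> (forall B, B \in s -> scalar_plus_strict B) ->
  shifted (d + size s).+1 (lie_comm A s).
Proof.
elim: s d A => [|B s IHs] d A sA ss; first by rewrite addn0.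
rewrite /= addnS -addSn; apply: IHs; last first.
  by move=> C sC; apply: ss; rewrite inE sC orbT.
rewrite -[A]add0r -(raddf0 (@scalar_mx F n)).
by apply: lie_bracket_shifted sA _; apply: ss; rewrite mem_head.
Qed.

Lemma scalar_plus_strict_lie_nilpotent m (S : {pred 'M[F]_n}) :
  (forall i, b i <= m)%N -> (0 < m)%N ->
  (forall A, A \in S -> scalar_plus_strict A) -> lie_nilpotent m S.
Proof.
move=> bm m_gt0 SR A [|B s] //= sz_s SA Ss; first by rewrite -sz_s in m_gt0.
have [c [A' [-> sA]]] := SR _ SA.
have sAB : shifted 2 (lie_bracket (c%:M + A') B).
  by apply: lie_bracket_shifted sA (SR _ _); apply: Ss; rewrite mem_head.
have : shifted m.+1 (lie_comm (lie_bracket (c%:M + A') B) s).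
  rewrite -sz_s -[(size s).+1]add1n; apply: lie_comm_shifted => // C sC.
  by apply/SR/Ss; rewrite inE sC orbT.
(* A nonzero entry in column [j] would force [b j] to be at least [m.+1]. *)
move=> s0; apply/matrixP=> i j; rewrite mxE; apply/eqP.
apply: contraT => /s0; rewrite addnS => ltmb.
by have := leq_trans (leq_ltn_trans (leq_addl _ _) ltmb) (bm j); rewrite ltnn.
Qed.

Let Pairs := {p : 'I_n * 'I_n | (b p.1 < b p.2)%N}.

(* The coordinate at [None] is the scalar part. *)
Definition strict_mx (f : {ffun option Pairs -> F^o}) : 'M[F]_n :=
  \matrix_(i, j)
     (f None *+ (i == j) + oapp (fun p => f (Some p)) 0 (insub (i, j))).

Fact strict_mx_linear : linear strict_mx.
Proof.
move=> c f g; apply/matrixP=> i j; rewrite !mxE !ffunE.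
rewrite mulrDr mulrnDl mulrnAr [RHS]addrACA; congr (_ + _).
case: insubP => [p _ _|_] /=; first by rewrite !ffunE.
by rewrite mulr0 addr0.
Qed.
HB.instance Definition _ := GRing.isLinear.Build F _ _ _ strict_mx
  strict_mx_linear.

(** As the image of a linear parametrisation, its dimension follows from injectivity. *)
Definition strict_vs : {vspace 'M[F]_n} := limg (linfun strict_mx).

Lemma strict_vsP A : reflect (scalar_plus_strict A) (A \in strict_vs).
Proof.
apply: (iffP memv_imgP) => [[f _ ->]|[c [B [-> sB]]]].
  exists (f None), (\matrix_(i, j) oapp (fun p => f (Some p)) 0 (insub (i, j))).
  split; first by apply/matrixP=> i j; rewrite lfunE !mxE.
  by move=> i j; rewrite mxE addn1; case: insubP => //=; rewrite eqxx.
exists [ffun q => if q is Some p then B (val p).1 (val p).2 else c].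
  exact: memvf.
apply/matrixP=> i j; rewrite lfunE !mxE ffunE; congr (_ + _).
case: insubP => [p _ /= def_p|]; first by rewrite ffunE def_p.
by apply: contraNeq => /sB; rewrite addn1.
Qed.

Lemma dim_strict_vs :
  (0 < n)%N ->
  \dim strict_vs = #|[pred p : 'I_n * 'I_n | (b p.1 < b p.2)%N]|.+1.
Proof.
move=> n_gt0; rewrite limg_dim_eq.
  by rewrite dimvf /dim /= muln1 card_option card_sig.
apply/eqP; rewrite capfv; apply/lker0P => f g.
rewrite !lfunE => /matrixP fg.
(* A diagonal position is never a strict pair, so its entry is the scalar part; [n_gt0] provides
   one. *)
have fg0 : f None = g None.
  have := fg (Ordinal n_gt0) (Ordinal n_gt0).
  by rewrite !mxE eqxx insubF ?ltnn //= !addr0.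
apply/ffunP => -[[[i j] ltij]|//]; have := fg i j.
by rewrite !mxE fg0 insubT /= => /addrI.
Qed.

End Shifted.

(** [T * T] splits into [L], its mirror image [G] under swapping, and the pairs [E] lying in a
    common fibre of [b]. *)
Lemma card_lt_pairs (T I : finType) (b : T -> I) (r : I -> nat) :
  injective r ->
  #|[pred p : T * T | (r (b p.1) < r (b p.2))%N]|
    = ((#|T| ^ 2 - \sum_(i : I) #|[pred x | b x == i]| ^ 2) %/ 2)%N.
Proof.
move=> r_inj.
set L := [pred p | _]; pose G := [pred p : T * T | (r (b p.2) < r (b p.1))%N].
pose E := [pred p : T * T | b p.1 == b p.2].
have cE : #|E| = (\sum_(i : I) #|[pred x | b x == i]| ^ 2)%N.
  rewrite -sum1_card (partition_big (fun p => b p.1) predT) //=.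
  apply: eq_bigr => i _; rewrite expnS expn1 -cardX sum1_card.
  apply: eq_card => -[x y]; rewrite !inE /=.
  rewrite unfold_in /= inE /=.
  by case: (eqVneq (b x) i) => [->|]; rewrite ?andbT ?andbF // eq_sym.
have cG : #|G| = #|L|.
  pose swap (p : T * T) := (p.2, p.1).
  have swapK : involutive swap by case.
  by rewrite -(card_image (inv_inj swapK)); apply: eq_card => p;
     rewrite -[p in LHS]swapK mem_image ?inE //; apply: inv_inj.
have cT : (#|T| ^ 2)%N = (#|L| * 2 + #|E|)%N.
  rewrite expnS expn1 -card_prod -[LHS](cardC L) muln2 -addnn -addnA.
  congr (_ + _)%N; rewrite -[in RHS]cG -(cardID G [predC L]); congr (_ + _)%N.
    apply: eq_card => p; rewrite !inE -leqNgt.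
    by case: ltnP => [/ltnW|]; rewrite ?andbF ?andbT.
  apply: eq_card => p; rewrite !inE -!leqNgt -(inj_eq r_inj) eqn_leq andbC.
  by rewrite andbC.
by rewrite cT -cE addnK mulnK.
Qed.

(** The disjoint union of the ['I_(k i)] has [n] elements; its tag map is transported along an
    enumeration. *)
Lemma exists_fibers (I : finType) n (k : I -> nat) :
  (\sum_i k i)%N = n ->
  exists b : 'I_n -> I, forall i, #|[pred x | b x == i]| = k i.
Proof.
move=> sum_k; pose T : finType := {i : I & 'I_(k i)}.
have cT : #|T| = n.
  rewrite card_tagged sumnE big_map big_enum -sum_k.
  by apply: eq_bigr => i _; rewrite card_ord.
pose h (x : 'I_n) : T := enum_val (cast_ord (esym cT) x).
have h_bij : bijective h.
  exact: bij_comp (@enum_val_bij T) (Bijective (cast_ordK _) (cast_ordKV _)).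
exists (fun x => tag (h x)) => i.
rewrite -[RHS]card_ord (bij_eq_card (@tag_with_bij I (fun i => 'I_(k i)) i)).
rewrite card_sig -[RHS](on_card_preimset (onW_bij _ h_bij)).
by apply: eq_card => x; rewrite !inE.
Qed.

Theorem theorem2 (F : fieldType) (m n : nat) :
  (0 < m)%N -> (0 < n)%N ->
  exists R : {vspace 'M[F]_n},
    [/\ GRing.mulr_closed (mem R),
        lie_nilpotent m (mem R)
      & \dim R = maxdim m.+1 n].
Proof.
move=> m_gt0 n_gt0.
pose K := [pred k : {ffun 'I_m.+1 -> 'I_n.+1} | (\sum_(i < m.+1) k i == n)%N].
have /eq_bigmax_cond K_gt0 : (0 < #|K|)%N.
  (* A single block of size [n], all others empty, shows that the maximum is attained. *)
  apply/card_gt0P; exists [ffun i => if i == ord0 then ord_max else ord0].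
  rewrite inE (bigD1 ord0) //= ffunE eqxx big1 ?addn0 // => i /negPf i0.
  by rewrite ffunE i0.
have [k /eqP sum_k max_k] := K_gt0 (fun k : {ffun 'I_m.+1 -> 'I_n.+1} =>
  (n ^ 2 - \sum_(i < m.+1) k i ^ 2) %/ 2 + 1)%N.
have [b cb] := @exists_fibers _ n (fun i => val (k i)) sum_k.
exists (strict_vs F (fun x => b x)); split.
- split=> [|A B /strict_vsP sA /strict_vsP sB]; apply/strict_vsP.
    exists 1, 0; split=> [|i j]; first by rewrite addr0.
    by rewrite mxE eqxx.
  exact: scalar_plus_strict_mulr_closed.
- apply: (@scalar_plus_strict_lie_nilpotent _ _ (fun x => b x)) => //.
    by move=> i; rewrite -ltnS.
  by move=> A /strict_vsP.
- rewrite dim_strict_vs // (card_lt_pairs b (@ord_inj m.+1)) card_ord -addn1.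
  rewrite [RHS]max_k; congr ((_ - _) %/ 2 + 1)%N.
  by apply: eq_bigr => i _; rewrite cb.
Qed.
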